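(* Let $f : X \to \mathbb{R}$ be such that the range of $f$ contains no infinite strictly increasing sequence. If Player I has a winning strategy in $\Gamma(f)$, then there exist $r \in \mathbb{R}$ and a Cantor set $C \subseteq X$ such that $C \cap \{f \ge r\}$ is countable and dense in $C$.
   Context: Let $A$ be a non-empty countable set and $T$ a pruned tree on $A$ (a set of finite sequences of elements of $A$, closed under initial segments, in which every sequence has a proper extension in $T$). Let $X$ be the set of infinite branches of $T$, with the topology generated by the cylinder sets $O(s) = \{x \in X : s \text{ is an initial segment of } x\}$, $s \in T$. A Cantor set is a subset homeomorphic to the middle-thirds Cantor set. $\{f \ge r\} = \{x \in X : f(x) \ge r\}$. The game $\Gamma(f)$: Player I and Player II alternate, Player I moving first; Player I plays $x_0, x_1, \dots \in A$ subject to $(x_0,\dots,x_t) \in T$ for all $t$, and after each move $x_t$ Player II plays a real number $v_t$. Player II wins the run iff $f(x_0,x_1,\dots) = \limsup_{t\to\infty} v_t$; otherwise Player I wins. *)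

(* Defs.v *)
From Stdlib Require Import Reals List.
From Coquelicot Require Import Coquelicot.
Import ListNotations.
Open Scope R_scope.

Definition countable_type (A : Type) : Prop :=
  exists e : A -> nat, forall a b, e a = e b -> a = b.

Definition is_tree {A : Type} (T : list A -> Prop) : Prop :=
  forall s n, T s -> T (firstn n s).

Definition is_pruned {A : Type} (T : list A -> Prop) : Prop :=
  forall s, T s -> exists t, T t /\ (length s < length t)%nat /\ firstn (length s) t = s.

Definition prefix {A : Type} (x : nat -> A) (n : nat) : list A :=
  map x (seq 0 n).

Definition is_branch {A : Type} (T : list A -> Prop) (x : nat -> A) : Prop :=
  forall n, T (prefix x n).

Definition Branches {A : Type} (T : list A -> Prop) : Type :=
  { x : nat -> A | is_branch T x }.

Definition bseq {A : Type} {T : list A -> Prop} (x : Branches T) : nat -> A :=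
  proj1_sig x.

Definition cylinder {A : Type} (T : list A -> Prop) (s : list A) (x : Branches T) : Prop :=
  prefix (bseq x) (length s) = s.

Definition openX {A : Type} {T : list A -> Prop} (U : Branches T -> Prop) : Prop :=
  forall x, U x -> exists s, T s /\ cylinder T s x /\ (forall y, cylinder T s y -> U y).

Definition dense_in {A : Type} {T : list A -> Prop} (S C : Branches T -> Prop) : Prop :=
  (forall x, S x -> C x) /\
  (forall U, openX U -> (exists x, C x /\ U x) -> exists y, S y /\ U y).

Definition countable_set {X : Type} (S : X -> Prop) : Prop :=
  exists e : X -> nat, forall x y, S x -> S y -> e x = e y -> x = y.

Definition middle_thirds_cantor (y : R) : Prop :=
  exists a : nat -> bool,
    infinite_sum (fun n => (if a n then 2 else 0) / 3 ^ (S n)) y.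

Definition is_cantor_set {A : Type} {T : list A -> Prop} (C : Branches T -> Prop) : Prop :=
  exists (h : Branches T -> R) (g : R -> Branches T),
    (forall x, C x -> middle_thirds_cantor (h x)) /\
    (forall y, middle_thirds_cantor y -> C (g y)) /\
    (forall x, C x -> g (h x) = x) /\
    (forall y, middle_thirds_cantor y -> h (g y) = y) /\
    (forall V : R -> Prop, open_set V ->
       exists U, openX U /\ forall x, C x -> (V (h x) <-> U x)) /\
    (forall U : Branches T -> Prop, openX U ->
       exists V : R -> Prop, open_set V /\
         forall y, middle_thirds_cantor y -> (U (g y) <-> V y)).

(* A strategy for Player I: given I's previous moves (x_0..x_{t-1}) and
   II's previous moves (v_0..v_{t-1}), choose x_t. *)
Definition strategyI (A : Type) : Type := list A -> list R -> A.

Definition vprefix (v : nat -> R) (t : nat) : list R := map v (seq 0 t).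

Fixpoint run_hist {A : Type} (sigma : strategyI A) (v : nat -> R) (t : nat) : list A :=
  match t with
  | O => []
  | S t' => run_hist sigma v t' ++ [sigma (run_hist sigma v t') (vprefix v t')]
  end.

Definition run {A : Type} (sigma : strategyI A) (v : nat -> R) (t : nat) : A :=
  sigma (run_hist sigma v t) (vprefix v t).

Definition winning_I {A : Type} {T : list A -> Prop} (f : Branches T -> R)
  (sigma : strategyI A) : Prop :=
  forall v : nat -> R,
    (forall t, T (prefix (run sigma v) (S t))) /\
    (forall x : Branches T, bseq x = run sigma v -> LimSup_seq v <> Finite (f x)).

Definition I_wins {A : Type} {T : list A -> Prop} (f : Branches T -> R) : Prop :=
  exists sigma : strategyI A, winning_I f sigma.

Definition no_increasing_seq_in_range {X : Type} (f : X -> R) : Prop :=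
  ~ exists u : nat -> R, (forall n, u n < u (S n)) /\ (forall n, exists x, f x = u n).

(* Main.v *)
(** Call a position of the game, together with a cap c, capped if every play that continues it with moves of Player II at most c has payoff at most c. Player II may move on to longer capped positions with smaller caps. Since the payoffs contain no strictly increasing sequence, there is a capped position p where the infimum r of the reachable caps is finite and largest possible; then r is also the infimum of the caps reachable from every position reachable from p, and every such position has a continuation with payoff at least r, respecting the cap. While following this continuation, Player II may at any time jump to a new position with cap close to r, playing a move at least r on the way. With finitely many jumps the payoff is at least r. With infinitely many jumps (to caps tending to r) the payoff is at most r and the limsup of Player II's moves is r, so the payoff is less than r because Player I wins. In particular jumping forever changes the branch, so jumps can be chosen to lead to incompatible branches. Encoding "jump" by true and "stay" by false embeds the Cantor space into X, and the points with payoff at least r are exactly the images of the eventually false sequences. *)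

Require Import Defs.
From Stdlib Require Import Reals List Lra Lia Classical ClassicalEpsilon FunctionalExtensionality.
From Coquelicot Require Import Coquelicot.
Open Scope R_scope.

(** * The Cantor set *)

Definition agree {B : Type} (k : nat) (a b : nat -> B) : Prop :=
  forall n, (n < k)%nat -> a n = b n.

Lemma agree_refl {B : Type} (k : nat) (a : nat -> B) : agree k a a.
Proof. intros n _; reflexivity. Qed.

Lemma agree_sym {B : Type} (k : nat) (a b : nat -> B) : agree k a b -> agree k b a.
Proof. intros H n Hn; symmetry; auto. Qed.

Lemma agree_trans {B : Type} (k : nat) (a b c : nat -> B) :
  agree k a b -> agree k b c -> agree k a c.
Proof. intros H1 H2 n Hn; rewrite H1 by exact Hn; auto. Qed.

Lemma agree_le {B : Type} (k m : nat) (a b : nat -> B) :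
  (k <= m)%nat -> agree m a b -> agree k a b.
Proof. intros Hkm H n Hn; apply H; lia. Qed.

Lemma agree_all {B : Type} (a b : nat -> B) : (forall k, agree k a b) -> a = b.
Proof. intros H; apply functional_extensionality; intros n; apply (H (S n)); lia. Qed.

Lemma agree_S_cons {B : Type} (k : nat) (a b : nat -> B) :
  a 0%nat = b 0%nat -> agree k (fun n => a (S n)) (fun n => b (S n)) -> agree (S k) a b.
Proof. intros H0 H [|n] Hn; [exact H0|apply H; lia]. Qed.

Lemma prefix_agree {B : Type} (n : nat) (x y : nat -> B) :
  prefix x n = prefix y n <-> agree n x y.
Proof.
  unfold prefix; rewrite map_ext_in_iff; split.
  - intros H i Hi; apply H, in_seq; lia.
  - intros H i Hi; apply in_seq in Hi; apply H; lia.
Qed.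

Lemma cylinder_agree {A : Type} (T : list A -> Prop) (n : nat) (x y : Branches T) :
  cylinder T (prefix (bseq x) n) y <-> agree n (bseq x) (bseq y).
Proof.
  unfold cylinder.
  assert (Hl : length (prefix (bseq x) n) = n)
    by (unfold prefix; rewrite length_map, length_seq; reflexivity).
  rewrite Hl, prefix_agree; split; apply agree_sym.
Qed.

Lemma cylinder_of_open {A : Type} {T : list A -> Prop} (U : Branches T -> Prop) (x : Branches T) :
  openX U -> U x -> exists n, forall y, agree n (bseq x) (bseq y) -> U y.
Proof.
  intros HU Hx; destruct (HU x Hx) as (s & _ & Hsx & Hs).
  exists (length s); intros y Hy; apply Hs.
  unfold cylinder in *; rewrite <- Hsx at 2; apply prefix_agree, agree_sym; exact Hy.
Qed.

Definition ternary_term (a : nat -> bool) (n : nat) : R :=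
  (if a n then 2 else 0) / 3 ^ (S n).

Definition ternary (a : nat -> bool) : R := Series (ternary_term a).

Lemma ternary_term_bounds (a : nat -> bool) (n : nat) :
  0 <= ternary_term a n <= 2 / 3 * (1 / 3) ^ n.
Proof.
  unfold ternary_term.
  assert (H3 : 0 < 3 ^ n) by (apply pow_lt; lra).
  assert (H : (1 / 3) ^ n = / 3 ^ n).
  { unfold Rdiv; rewrite Rmult_1_l; apply pow_inv. }
  assert (Hi : 0 < / 3 ^ n) by (apply Rinv_0_lt_compat; exact H3).
  rewrite H; simpl; unfold Rdiv; rewrite Rinv_mult; destruct (a n); lra.
Qed.

Lemma is_series_ternary_bound : is_series (fun n => 2 / 3 * (1 / 3) ^ n) 1.
Proof.
  assert (E : scal (2 / 3) (/ (1 - 1 / 3)) = 1)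
    by (unfold scal; simpl; unfold mult; simpl; field).
  refine (eq_ind _ (is_series (fun n => 2 / 3 * (1 / 3) ^ n)) _ _ E).
  apply (is_series_scal (V := R_NormedModule) (2 / 3) (fun n => (1 / 3) ^ n)).
  apply is_series_geom; rewrite Rabs_right; lra.
Qed.

Lemma ex_series_ternary (a : nat -> bool) : ex_series (ternary_term a).
Proof.
  apply (ex_series_le (V := R_CompleteNormedModule) _ (fun n => 2 / 3 * (1 / 3) ^ n)).
  - intros n; destruct (ternary_term_bounds a n) as [H1 H2].
    change (norm (ternary_term a n)) with (Rabs (ternary_term a n)).
    rewrite Rabs_right; lra.
  - exists 1; exact is_series_ternary_bound.
Qed.

Lemma ternary_bounds (a : nat -> bool) : 0 <= ternary a <= 1.
Proof.
  unfold ternary; split.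
  - replace 0 with (Series (fun n => 0 * ternary_term a n))
      by (rewrite Series_scal_l; ring).
    apply Series_le; [|apply ex_series_ternary].
    intros n; destruct (ternary_term_bounds a n); split; lra.
  - rewrite <- (is_series_unique _ _ is_series_ternary_bound).
    apply Series_le; [apply ternary_term_bounds|].
    exists 1; exact is_series_ternary_bound.
Qed.

Lemma ternary_unfold (a : nat -> bool) :
  ternary a = (if a 0%nat then 2 else 0) / 3 + ternary (fun n => a (S n)) / 3.
Proof.
  unfold ternary; rewrite Series_incr_1 by apply ex_series_ternary; f_equal.
  - unfold ternary_term; simpl; field.
  - unfold Rdiv; rewrite Rmult_comm, <- Series_scal_l; apply Series_ext.
    intros n; unfold ternary_term; simpl; field; apply pow_nonzero; lra.
Qed.

(** Self-similarity: removing a common first digit multiplies the distance by 3, and all values lie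
    in the unit interval. *)
Lemma ternary_close_of_agree (k : nat) : forall a b : nat -> bool,
  agree k a b -> Rabs (ternary a - ternary b) <= (1 / 3) ^ k.
Proof.
  induction k as [|k IH]; intros a b H.
  - pose proof (ternary_bounds a); pose proof (ternary_bounds b).
    simpl; apply Rabs_le; lra.
  - rewrite (ternary_unfold a), (ternary_unfold b), (H 0%nat) by lia.
    assert (H' : agree k (fun n => a (S n)) (fun n => b (S n))) by (intros n Hn; apply H; lia).
    apply IH, Rabs_le_between in H'.
    simpl; apply Rabs_le; destruct (b 0%nat); lra.
Qed.

(** Different first digits put the values on opposite sides of the removed middle third, at distance
    at least 1/3; otherwise strip the digit and rescale. *)
Lemma agree_of_ternary_close (k : nat) : forall a b : nat -> bool,
  Rabs (ternary a - ternary b) < (1 / 3) ^ k -> agree k a b.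
Proof.
  induction k as [|k IH]; intros a b H.
  - intros n Hn; lia.
  - rewrite (ternary_unfold a), (ternary_unfold b) in H.
    apply Rabs_lt_between in H; simpl in H.
    assert (Hk : (1 / 3) ^ k <= 1) by (rewrite <- (pow1 k) at 2; apply pow_incr; lra).
    pose proof (ternary_bounds (fun n => a (S n))).
    pose proof (ternary_bounds (fun n => b (S n))).
    assert (E0 : a 0%nat = b 0%nat)
      by (destruct (a 0%nat), (b 0%nat); try reflexivity; lra).
    apply agree_S_cons; [exact E0|].
    rewrite E0 in H; apply IH, Rabs_lt_between.
    destruct (b 0%nat); lra.
Qed.

Lemma ternary_inj (a b : nat -> bool) : ternary a = ternary b -> a = b.
Proof.
  intros H; apply agree_all; intros k; apply agree_of_ternary_close.
  rewrite H, Rminus_diag, Rabs_R0; apply pow_lt; lra.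
Qed.

Lemma middle_thirds_cantor_ternary (y : R) :
  middle_thirds_cantor y <-> exists a, ternary a = y.
Proof.
  split; intros [a Ha]; exists a.
  - apply is_series_unique, is_series_Reals; exact Ha.
  - apply is_series_Reals; rewrite <- Ha; apply Series_correct, ex_series_ternary.
Qed.

Lemma pow_third_small (eps : R) : 0 < eps -> exists k, (1 / 3) ^ k < eps.
Proof.
  intros He; destruct (pow_lt_1_zero (1 / 3)) with (y := eps) as [N HN];
    [rewrite Rabs_right; lra|exact He|].
  exists N; specialize (HN N (Nat.le_refl N)).
  rewrite Rabs_right in HN; [exact HN|]; apply Rle_ge, pow_le; lra.
Qed.

(** The two hypotheses are continuity of [phi] and of its inverse, stated by finite agreement; the
    second also gives injectivity. Composing with [ternary] yields the homeomorphism. *)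
Lemma is_cantor_set_of_embedding {A : Type} {T : list A -> Prop}
  (phi : (nat -> bool) -> Branches T)
  (phi_cont : forall a n, exists k, forall b, agree k a b ->
     agree n (bseq (phi a)) (bseq (phi b)))
  (phi_open : forall a k, exists n, forall b,
     agree n (bseq (phi a)) (bseq (phi b)) -> agree k a b) :
  is_cantor_set (fun x => exists a, phi a = x).
Proof.
  assert (phi_inj : forall a b, phi a = phi b -> a = b).
  { intros a b H; apply agree_all; intros k.
    destruct (phi_open a k) as [n Hn]; apply Hn; rewrite H; apply agree_refl. }
  pose (inh := inhabits (fun _ : nat => false)).
  (* Both inverses are total by choice; their values off the image are arbitrary and never
     matter. *)
  pose (code := fun x => epsilon inh (fun a => phi a = x)).
  pose (digits := fun y => epsilon inh (fun a => ternary a = y)).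
  assert (code_phi : forall a, code (phi a) = a).
  { intros a; apply phi_inj; apply (epsilon_spec inh (fun b => phi b = phi a)).
    exists a; reflexivity. }
  assert (digits_ternary : forall a, digits (ternary a) = a).
  { intros a; apply ternary_inj; apply (epsilon_spec inh (fun b => ternary b = ternary a)).
    exists a; reflexivity. }
  exists (fun x => ternary (code x)), (fun y => phi (digits y)).
  split; [|split; [|split; [|split; [|split]]]].
  - intros x _; apply middle_thirds_cantor_ternary; eexists; reflexivity.
  - intros y _; eexists; reflexivity.
  - intros x [a <-]; rewrite code_phi, digits_ternary; reflexivity.
  - intros y Hy; apply middle_thirds_cantor_ternary in Hy; destruct Hy as [a <-].
    rewrite digits_ternary, code_phi; reflexivity.
  - intros V HV.
    (* The union of all cylinders whose points in the image of [phi] have their code in [V]. *)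
    exists (fun x => exists n, forall a, agree n (bseq x) (bseq (phi a)) -> V (ternary a)).
    split.
    + intros x [n Hn]; exists (prefix (bseq x) n); split; [apply (proj2_sig x)|].
      split; [apply cylinder_agree, agree_refl|].
      intros y Hy; apply cylinder_agree in Hy; exists n; intros a Ha; apply Hn.
      apply (agree_trans _ _ _ _ Hy Ha).
    + intros x [a <-]; rewrite code_phi; split.
      * intros Ha; destruct (HV _ Ha) as [eps Heps].
        destruct (pow_third_small eps (cond_pos eps)) as [k Hk].
        destruct (phi_open a k) as [n Hn]; exists n; intros b Hb; apply Heps.
        unfold disc; eapply Rle_lt_trans; [|exact Hk].
        apply ternary_close_of_agree, agree_sym, Hn, Hb.
      * intros [n Hn]; apply Hn, agree_refl.
  - intros U HU.
    (* The reals with a neighbourhood whose Cantor points are all sent into [U]; halving the radius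
       shows that this set is open. *)
    exists (fun z => exists eps : R, 0 < eps /\ forall b, Rabs (ternary b - z) < eps -> U (phi b)).
    split.
    + intros z (eps & He & Hz); exists (mkposreal (eps / 2) ltac:(lra)).
      intros z' Hz'; unfold disc in Hz'; simpl in Hz'.
      exists (eps / 2); split; [lra|]; intros b Hb; apply Hz.
      replace (ternary b - z) with ((ternary b - z') + (z' - z)) by ring.
      eapply Rle_lt_trans; [apply Rabs_triang|lra].
    + intros y Hy; apply middle_thirds_cantor_ternary in Hy; destruct Hy as [a <-].
      rewrite digits_ternary; split.
      * intros Ha; destruct (cylinder_of_open U _ HU Ha) as [n Hn].
        destruct (phi_cont a n) as [k Hk]; exists ((1 / 3) ^ k).
        split; [apply pow_lt; lra|].
        intros b Hb; apply Hn, Hk, agree_sym, agree_of_ternary_close, Hb.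
      * intros (eps & He & Hb); apply Hb; rewrite Rminus_diag, Rabs_R0; exact He.
Qed.

(** * The game *)

Lemma dependent_choice {B : Type} (P : B -> Prop) (Q : nat -> B -> B -> Prop) (b : B) :
  P b -> (forall n c, P c -> exists d, P d /\ Q n c d) ->
  exists u : nat -> B, u 0%nat = b /\ forall n, P (u n) /\ Q n (u n) (u (S n)).
Proof.
  intros Hb Hstep.
  pose (next := fun n c => epsilon (inhabits b) (fun d => P d /\ Q n c d)).
  assert (Hnext : forall n c, P c -> P (next n c) /\ Q n c (next n c)).
  { intros n c Hc; apply (epsilon_spec (inhabits b) (fun d => P d /\ Q n c d)); auto. }
  pose (u := nat_rect (fun _ => B) b next).
  assert (Hu : forall n, P (u n)) by (induction n; [exact Hb|apply Hnext; assumption]).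
  exists u; split; [reflexivity|]; intros n; split; [apply Hu|].
  apply (Hnext n (u n)), Hu.
Qed.

Lemma increasing_sequence_of_no_max (Z : R -> Prop) :
  (exists z, Z z) -> (forall z, Z z -> exists z', Z z' /\ z < z') ->
  exists u : nat -> R, forall n, Z (u n) /\ u n < u (S n).
Proof.
  intros [z Hz] Hmax.
  destruct (dependent_choice Z (fun _ c d => c < d) z Hz (fun _ => Hmax)) as (u & _ & Hu).
  exists u; exact Hu.
Qed.

(** Only the moves before [time] are fixed; the rest of [moves] is a provisional continuation. *)
Record position : Type := Position { moves : nat -> R; time : nat; cap : R }.

Definition continues (p : position) (w : nat -> R) : Prop :=
  agree (time p) (moves p) w /\ forall t, (time p <= t)%nat -> w t <= cap p.

Definition wait (p : position) (n : nat) : position :=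
  Position (moves p) (max (time p) n) (cap p).

(** With strictly increasing times, entry [t] is already fixed at position [S t]. *)
Definition limit_moves (u : nat -> position) (t : nat) : R := moves (u (S t)) t.

(** * Capped positions and reachability *)

Section Payoff.

(** The payoff in terms of Player II's moves alone, Player I's answers being given by a fixed
    strategy. *)
Variable F : (nat -> R) -> R.
Hypothesis F_range : no_increasing_seq_in_range F.

Definition capped (p : position) : Prop :=
  continues p (moves p) /\ forall w, continues p w -> F w <= cap p.

Definition reach (p q : position) : Prop :=
  (time p <= time q)%nat /\ cap q <= cap p /\ continues p (moves q) /\ capped q.

Lemma reach_refl (p : position) : capped p -> reach p p.
Proof. intros H; split; [lia|split; [lra|split; [apply H|exact H]]]. Qed.

Lemma continues_of_reach (p q : position) (w : nat -> R) :
  reach p q -> continues q w -> continues p w.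
Proof.
  intros (Ht & Hc & [H1 H2] & _) [H3 H4]; split.
  - intros t Hlt; rewrite H1 by exact Hlt; apply H3; lia.
  - intros t Hle; destruct (Nat.lt_ge_cases t (time q)) as [Hlt|Hge].
    + rewrite <- H3 by exact Hlt; apply H2, Hle.
    + specialize (H4 t Hge); lra.
Qed.

Lemma reach_trans (p q s : position) : reach p q -> reach q s -> reach p s.
Proof.
  intros Hpq Hqs; split; [destruct Hpq, Hqs; lia|].
  split; [destruct Hpq as (_ & ? & _), Hqs as (_ & ? & _); lra|].
  split; [apply (continues_of_reach _ _ _ Hpq)|]; apply Hqs.
Qed.

Lemma reach_capped (p q : position) : reach p q -> capped q.
Proof. intros H; apply H. Qed.

Lemma reach_wait (p : position) (n : nat) : capped p -> reach p (wait p n).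
Proof.
  intros [H1 H2]; unfold wait; split; [simpl; lia|split; [simpl; lra|]].
  split; [exact H1|split].
  - split; [apply agree_refl|]; simpl; intros t Ht; apply H1; lia.
  - simpl; intros w [H3 H4]; simpl in *; apply H2; split.
    + eapply agree_le; [|exact H3]; lia.
    + intros t Ht; destruct (Nat.lt_ge_cases t (max (time p) n)) as [Hlt|Hge]; [|auto].
      rewrite <- H3 by exact Hlt; apply H1, Ht.
Qed.

(** Being capped concerns only the fixed moves and the cap, so the provisional continuation may be
    exchanged for any admissible one. *)
Lemma capped_redirect (p : position) (w : nat -> R) :
  capped p -> continues p w -> reach p (Position w (time p) (cap p)).
Proof.
  intros [_ H] [H1 H2]; split; [simpl; lia|split; [simpl; lra|]].
  split; [split; assumption|split].
  - split; [apply agree_refl|exact H2].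
  - simpl; intros w' [H3 H4]; simpl in *; apply H; split; [|exact H4].
    apply (agree_trans _ _ _ _ H1 H3).
Qed.

Lemma exists_max_payoff (P : (nat -> R) -> Prop) :
  (exists w, P w) -> exists w, P w /\ forall w', P w' -> F w' <= F w.
Proof.
  intros [w0 Hw0]; apply NNPP; intros Hno; apply F_range.
  destruct (increasing_sequence_of_no_max (fun z => exists w, P w /\ F w = z)) as [u Hu].
  - exists (F w0), w0; auto.
  - intros z (w & Hw & <-); apply NNPP; intros Hz; apply Hno; exists w; split; [exact Hw|].
    intros w' Hw'; apply Rnot_lt_le; intros Hlt; apply Hz; exists (F w'); eauto.
  - exists u; split; [apply Hu|]; intros n; destruct (Hu n) as [(w & _ & Hw) _]; eauto.
Qed.

Lemma exists_capped : exists p, capped p.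
Proof.
  destruct (exists_max_payoff (fun _ => True)) as (w & _ & Hw); [exists (fun _ => 0); exact I|].
  exists (Position (fun _ => F w) 0 (F w)); split; simpl.
  - split; [apply agree_refl|]; simpl; intros; lra.
  - intros w' _; apply Hw, I.
Qed.

(** The largest payoff of a continuation can serve as the new cap, since a lower cap admits fewer
    continuations. The constant tail makes the provisional moves respect it. *)
Lemma capped_max (p : position) : capped p ->
  exists w, continues p w /\ F w <= cap p /\ reach p (Position (fun t =>
    if Nat.ltb t (time p) then moves p t else F w) (time p) (F w)).
Proof.
  intros [Hp Hb].
  destruct (exists_max_payoff (continues p)) as (w & Hw & Hmax); [eauto|].
  assert (Hle : F w <= cap p) by auto.
  assert (Hag : agree (time p) (moves p)
                  (fun t => if Nat.ltb t (time p) then moves p t else F w)).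
  { intros t Ht; destruct (Nat.ltb_spec t (time p)); [reflexivity|lia]. }
  exists w; split; [exact Hw|split; [exact Hle|]].
  split; [simpl; lia|split; [exact Hle|split; [split; [exact Hag|]|split; [split|]]]]; simpl.
  - intros t Ht; destruct (Nat.ltb_spec t (time p)); [lia|exact Hle].
  - apply agree_refl.
  - intros t Ht; destruct (Nat.ltb_spec t (time p)); [lia|lra].
  - intros w' [H1 H2]; simpl in *; apply Hmax; split; [apply (agree_trans _ _ _ _ Hag H1)|].
    intros t Ht; specialize (H2 t Ht); lra.
Qed.

(** * Limits of chains of positions *)

Section Chain.

Variable u : nat -> position.
Hypothesis u_reach : forall k, reach (u k) (u (S k)).
Hypothesis u_time : forall k, (time (u k) < time (u (S k)))%nat.

(** Equality is kept apart because [reach] makes only its target capped, so [u 0] need not reach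
    itself. *)
Lemma chain_reach (i j : nat) : (i <= j)%nat -> reach (u i) (u j) \/ i = j.
Proof.
  induction 1 as [|j _ [IH| ->]]; [right; reflexivity| |left; apply u_reach].
  left; apply (reach_trans _ _ _ IH), u_reach.
Qed.

Lemma chain_time (k : nat) : (k <= time (u k))%nat.
Proof. induction k as [|k IH]; [lia|]; specialize (u_time k); lia. Qed.

Lemma chain_agree (i j : nat) : (i <= j)%nat -> agree (time (u i)) (moves (u i)) (moves (u j)).
Proof.
  intros Hij; destruct (chain_reach i j Hij) as [H| ->]; [apply H|apply agree_refl].
Qed.

Lemma chain_moves (k t : nat) : (t < time (u k))%nat -> limit_moves u t = moves (u k) t.
Proof.
  intros Ht; unfold limit_moves; pose proof (chain_time (S t)).
  rewrite (chain_agree (S t) (max k (S t))) by lia.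
  rewrite (chain_agree k (max k (S t))) by lia; reflexivity.
Qed.

Lemma continues_limit (k : nat) : continues (u k) (limit_moves u).
Proof.
  split.
  - intros t Ht; symmetry; apply chain_moves, Ht.
  - intros t Ht; pose proof (chain_time (S t)).
    (* An index above [k], so that [u k] reaches it, and above [t], so that entry [t] is fixed
       there. *)
    rewrite (chain_moves (max (S k) (S t))).
    + destruct (chain_reach k (max (S k) (S t))) as [H'|H']; [lia| |lia].
      apply H', Ht.
    + pose proof (chain_time (max (S k) (S t))); lia.
Qed.

End Chain.

(* If the caps could always be pushed to minus infinity, a single play would have payoff below every cap. *)
Lemma exists_capped_bounded :
  exists p b, capped p /\ forall q, reach p q -> b <= cap q.
Proof.
  apply NNPP; intros Hno; destruct exists_capped as [p0 Hp0].
  destruct (dependent_choice capped (fun n p q =>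
    reach p q /\ (time p < time q)%nat /\ cap q < - INR n) p0 Hp0) as (u & _ & Hu).
  - intros n p Hp.
    (* Waiting one move first forces the time to increase strictly. *)
    assert (Hw := reach_wait p (S (time p)) Hp).
    assert (H : exists q, reach (wait p (S (time p))) q /\ cap q < - INR n).
    { apply NNPP; intros H; apply Hno; exists (wait p (S (time p))), (- INR n).
      split; [apply Hw|]; intros q Hq; apply Rnot_lt_le; intros Hlt; eauto. }
    destruct H as (q & Hq & Hcap); exists q; split; [apply Hq|].
    split; [apply (reach_trans _ _ _ Hw Hq)|]; split; [|exact Hcap].
    destruct Hq as [Hq _]; simpl in Hq; lia.
  - destruct (INR_unbounded (- F (limit_moves u))) as [n Hn].
    assert (H : F (limit_moves u) <= cap (u (S n))).
    { apply (proj1 (Hu (S n))), continues_limit; intros k; apply (Hu k). }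
    destruct (Hu n) as (_ & _ & _ & Hc); lra.
Qed.

(** * The infimum of the reachable caps *)

Definition cap_inf (p : position) (r : R) : Prop :=
  (forall q, reach p q -> r <= cap q) /\
  (forall eps, 0 < eps -> exists q, reach p q /\ cap q < r + eps).

Lemma exists_cap_inf (p : position) (b : R) :
  capped p -> (forall q, reach p q -> b <= cap q) -> exists r, b <= r /\ cap_inf p r.
Proof.
  intros Hp Hb.
  destruct (completeness (fun x => exists q, reach p q /\ x = - cap q)) as [m [Hub Hlub]].
  - exists (- b); intros x (q & Hq & ->); specialize (Hb q Hq); lra.
  - exists (- cap p), p; split; [apply reach_refl, Hp|reflexivity].
  - exists (- m); split; [|split].
    + assert (m <= - b); [|lra].
      apply Hlub; intros x (q & Hq & ->); specialize (Hb q Hq); lra.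
    + intros q Hq; assert (- cap q <= m) by (apply Hub; eauto); lra.
    + intros eps He; apply NNPP; intros Hno.
      assert (m <= m - eps); [|lra].
      apply Hlub; intros x (q & Hq & ->); apply Rnot_lt_le; intros Hlt.
      apply Hno; exists q; split; [exact Hq|lra].
Qed.

(** The largest payoff among the continuations is itself a reachable cap. *)
Lemma exists_payoff_ge (p : position) (r : R) :
  capped p -> (forall q, reach p q -> r <= cap q) ->
  exists w, continues p w /\ r <= F w <= cap p.
Proof.
  intros Hp Hr; destruct (capped_max p Hp) as (w & Hw & Hle & Hreach).
  exists w; split; [exact Hw|split; [apply (Hr _ Hreach)|exact Hle]].
Qed.

(* A strictly increasing sequence of infima of caps would interleave with payoffs, so there is a largest infimum; it is inherited by every position reachable from a maximizing one. *)
Lemma exists_stable_cap_inf :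
  exists p r, capped p /\ forall q, reach p q -> cap_inf q r.
Proof.
  apply NNPP; intros Hno.
  destruct (increasing_sequence_of_no_max (fun r => exists p, capped p /\ cap_inf p r))
    as [z Hz].
  - destruct exists_capped_bounded as (p & b & Hp & Hb).
    destruct (exists_cap_inf p b Hp Hb) as (r & _ & Hr); eauto.
  - intros r (p & Hp & Hinf); apply NNPP; intros Hmax; apply Hno; exists p, r.
    split; [exact Hp|]; intros q Hq.
    destruct (exists_cap_inf q r (reach_capped _ _ Hq)) as (r' & Hle & Hr').
    { intros s Hs; apply Hinf, (reach_trans _ _ _ Hq Hs). }
    destruct Hle as [Hlt| ->]; [|exact Hr'].
    exfalso; apply Hmax; exists r'; split; [|exact Hlt].
    exists q; split; [apply Hq|exact Hr'].
  - assert (Hw : forall n, exists w, z n <= F w < z (S n)).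
    { intros n; destruct (Hz n) as [(p & Hp & Hinf1 & Hinf2) Hlt].
      destruct (Hinf2 (z (S n) - z n)) as (q & Hq & Hcap); [lra|].
      destruct (exists_payoff_ge q (z n)) as (w & _ & Hw); [apply Hq| |exists w; lra].
      intros s Hs; apply Hinf1, (reach_trans _ _ _ Hq Hs). }
    apply F_range; apply choice in Hw; destruct Hw as [w Hw].
    exists (fun n => F (w n)); split; [|eauto].
    intros n; pose proof (Hw n); pose proof (Hw (S n)); lra.
Qed.

End Payoff.

(** * Jumps and the binary scheme *)

Section Scheme.

Variables (A : Type) (F : (nat -> R) -> R) (X : (nat -> R) -> nat -> A).
(** [X v] is the branch Player I produces against [v]; moving first, Player I is one move ahead. *)
Hypothesis X_causal : forall n v w, agree n v w -> agree (S n) (X v) (X w).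
Hypothesis F_X : forall v w, X v = X w -> F v = F w.
Hypothesis F_range : no_increasing_seq_in_range F.
Hypothesis F_limsup : forall v, LimSup_seq v <> Finite (F v).

Variables (p0 : position) (r : R).
Hypothesis p0_capped : capped F p0.
Hypothesis p0_inf : forall q, reach F p0 q -> cap_inf F q r.

Definition good (p : position) : Prop := reach F p0 p /\ r <= F (moves p).

Definition jump (eps : R) (p q : position) : Prop :=
  good q /\ reach F p q /\ (time p < time q)%nat /\ cap q < r + eps /\
  exists t, (time p <= t < time q)%nat /\ r <= moves q t.

Lemma exists_good (p : position) : reach F p0 p ->
  exists q, good q /\ reach F p q /\ time q = time p /\ cap q = cap p.
Proof.
  intros Hp; destruct (exists_payoff_ge F F_range p r) as (w & Hw & Hr & _).
  - apply (reach_capped _ _ _ Hp).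
  - apply p0_inf, Hp.
  - assert (H := capped_redirect F p w (reach_capped _ _ _ Hp) Hw).
    exists (Position w (time p) (cap p)); split; [split; [|exact Hr]|split; [exact H|auto]].
    apply (reach_trans _ _ _ _ Hp H).
Qed.

Lemma good_wait (p : position) (n : nat) : good p -> good (wait p n).
Proof.
  intros [H1 H2]; split; [|exact H2].
  apply (reach_trans _ _ _ _ H1), reach_wait, H1.
Qed.

(** Go to a position with cap below [r + eps], play the cap itself once (it is at least [r]), and
    only then choose a continuation with payoff at least [r]. *)
Lemma exists_jump (eps : R) (p : position) : 0 < eps -> good p -> exists q, jump eps p q.
Proof.
  intros He [Hp Hr].
  destruct (p0_inf p Hp) as [_ Hinf]; destruct (Hinf eps He) as (p1 & H1 & Hc1).
  destruct (capped_redirect F p1 (fun t => if Nat.ltb t (time p1) then moves p1 t else cap p1))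
    as (_ & _ & Hcont & Hcap).
  - apply H1.
  - split; intros t Ht; destruct (Nat.ltb_spec t (time p1)); try lia; [reflexivity|lra].
  - set (p2 := Position _ _ _) in *.
    assert (H12 : reach F p1 p2) by (split; [simpl; lia|split; [simpl; lra|auto]]).
    (* Waiting past [time p1] fixes the move equal to the cap, so later redirection cannot remove
       it. *)
    assert (H23 := reach_wait F p2 (S (time p1)) Hcap).
    assert (H13 := reach_trans _ _ _ _ H12 H23).
    assert (Hp3 := reach_trans _ _ _ _ H1 H13).
    destruct (exists_good _ (reach_trans _ _ _ _ Hp Hp3)) as (q & Hq & H3q & Ht & Hc).
    simpl in Ht, Hc; exists q; split; [exact Hq|].
    split; [apply (reach_trans _ _ _ _ Hp3 H3q)|].
    assert (Htime := proj1 H1); split; [lia|split; [lra|]].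
    exists (time p1); split; [lia|].
    destruct H3q as (_ & _ & [H3q _] & _); rewrite <- H3q by (simpl; lia).
    simpl; rewrite Nat.ltb_irrefl.
    apply (p0_inf p0 (reach_refl _ _ p0_capped)), (reach_trans _ _ _ _ Hp).
    exact H1.
Qed.

Lemma jump_trans (eps : R) (p q s : position) :
  jump eps p q -> good s -> reach F q s -> jump eps p s.
Proof.
  intros (Hq & Hpq & Ht & Hc & t & Hlt & Hr) Hs Hqs; split; [exact Hs|].
  split; [apply (reach_trans _ _ _ _ Hpq Hqs)|].
  destruct Hqs as (Ht' & Hc' & [Hag _] & _); split; [lia|split; [lra|]].
  exists t; split; [lia|]; rewrite <- Hag by lia; exact Hr.
Qed.

(** Caps tending to [r] bound both the payoff and the limsup of the moves by [r]; the recurring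
    moves at least [r] make the limsup equal to [r], and Player I's win excludes payoff [r]. *)
Lemma payoff_limit_lt (u : nat -> position) :
  (forall k, reach F (u k) (u (S k))) ->
  (forall k, (time (u k) < time (u (S k)))%nat) ->
  (forall eps, 0 < eps -> exists k, cap (u k) < r + eps) ->
  (forall N, exists t, (N <= t)%nat /\ r <= limit_moves u t) ->
  F (limit_moves u) < r.
Proof.
  intros Hreach Htime Hcap Hoften.
  assert (Hcont := continues_limit F u Hreach Htime).
  assert (Hle : F (limit_moves u) <= r).
  { apply Rnot_lt_le; intros Hlt.
    destruct (Hcap (F (limit_moves u) - r)) as [k Hk]; [lra|].
    destruct (Hreach k) as (_ & Hck & _ & _ & Hbound).
    specialize (Hbound _ (Hcont (S k))); lra. }
  destruct Hle as [Hlt|Heq]; [exact Hlt|].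
  exfalso; apply (F_limsup (limit_moves u)); rewrite Heq.
  apply is_LimSup_seq_unique; intros eps; pose proof (cond_pos eps); split.
  - intros N; destruct (Hoften N) as (t & Ht & Hr); exists t; split; [exact Ht|lra].
  - destruct (Hcap eps) as [k Hk]; [assumption|]; exists (time (u k)); intros t Ht.
    destruct (Hcont k) as [_ H']; specialize (H' t Ht); lra.
Qed.

Definition split_jump (eps : R) (p q : position) : Prop :=
  jump eps p q /\ ~ agree (time q) (X (moves p)) (X (moves q)).

(* Jumping forever yields a payoff below r, hence a branch other than that of the good position p; the two branches already differ after finitely many jumps. *)
Lemma exists_split_jump (eps : R) (p : position) :
  0 < eps -> good p -> exists q, split_jump eps p q.
Proof.
  intros He Hp.
  (* The first jump uses exactly [eps], as the conclusion demands; the later tolerances tend to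
     0. *)
  destruct (dependent_choice good (fun n s q => jump (eps / INR (S n)) s q) p Hp)
    as (u & H0 & Hu).
  { intros n s Hs; destruct (exists_jump (eps / INR (S n)) s) as [q Hq]; [|exact Hs|].
    - apply Rdiv_lt_0_compat; [exact He|apply lt_0_INR; lia].
    - exists q; split; [apply Hq|exact Hq]. }
  assert (Hreach : forall k, reach F (u k) (u (S k))) by (intros k; apply (Hu k)).
  assert (Htime : forall k, (time (u k) < time (u (S k)))%nat) by (intros k; apply (Hu k)).
  assert (Hlt : F (limit_moves u) < r).
  { apply payoff_limit_lt; [exact Hreach|exact Htime| |].
    - intros d Hd; destruct (INR_unbounded (eps / d)) as [n Hn]; exists (S n).
      destruct (Hu n) as (_ & _ & _ & _ & Hc & _); eapply Rlt_trans; [exact Hc|].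
      assert (eps / INR (S n) < d); [|lra].
      assert (HS : 0 < INR (S n)) by (apply lt_0_INR; lia).
      apply (Rmult_lt_reg_r (INR (S n))); [exact HS|].
      unfold Rdiv; rewrite Rmult_assoc, Rinv_l, Rmult_1_r by lra.
      rewrite S_INR in *; apply (Rmult_lt_compat_l d) in Hn; [|exact Hd].
      replace (d * (eps / d)) with eps in Hn by (field; lra); lra.
    - intros N; destruct (Hu N) as (_ & _ & _ & _ & _ & t & Ht & Hr); exists t.
      pose proof (chain_time u Htime N); split; [lia|].
      rewrite (chain_moves F u Hreach Htime (S N)) by lia; exact Hr. }
  assert (Hdiff : exists k, ~ agree k (X (moves p)) (X (limit_moves u))).
  { apply not_all_ex_not; intros Hall; apply agree_all, F_X in Hall.
    destruct Hp as [_ Hp]; lra. }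
  (* [S k] guarantees at least one jump and a time beyond the disagreement. *)
  destruct Hdiff as [k Hk]; exists (u (S k)); split.
  - destruct (Hu 0%nat) as [_ Hj]; rewrite H0 in Hj; simpl in Hj.
    replace (eps / 1) with eps in Hj by field.
    destruct (chain_reach F u Hreach 1 (S k)) as [H|H]; [lia| |rewrite <- H; exact Hj].
    apply (jump_trans _ _ _ _ Hj); [apply Hu|exact H].
  - intros Hag; apply Hk.
    pose proof (chain_time u Htime (S k)).
    apply (agree_trans _ _ (X (moves (u (S k))))); [eapply agree_le; [|exact Hag]; lia|].
    eapply agree_le; [|apply X_causal, (proj1 (continues_limit F u Hreach Htime (S k)))]; lia.
Qed.

(** The child that stays waits until the time of the sibling that jumps, so both are compared at the
    same length. *)
Fixpoint node (J : nat -> position -> position) (p : position) (a : nat -> bool) (k : nat)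
  : position :=
  match k with
  | O => p
  | S k => let q := node J p a k in if a k then J k q else wait q (time (J k q))
  end.

Lemma node_agree (J : nat -> position -> position) (p : position) (a b : nat -> bool) (k : nat) :
  agree k a b -> node J p a k = node J p b k.
Proof.
  induction k as [|k IH]; intros H; [reflexivity|]; simpl.
  rewrite (H k), IH by (try (eapply agree_le; [|exact H]); lia); reflexivity.
Qed.

Lemma exists_binary_scheme : exists W : (nat -> bool) -> nat -> R,
  (forall a n, exists k, forall b, agree k a b -> agree n (X (W a)) (X (W b))) /\
  (forall a k, exists n, forall b, agree n (X (W a)) (X (W b)) -> agree k a b) /\
  (forall a, r <= F (W a) <-> exists k, forall j, (k <= j)%nat -> a j = false).
Proof.
  destruct (exists_good p0 (reach_refl _ _ p0_capped)) as (p & Hp & _).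
  assert (HJ : exists J : nat -> position -> position,
    forall n q, good q -> split_jump (/ INR (S n)) q (J n q)).
  { exists (fun n q => epsilon (inhabits p) (split_jump (/ INR (S n)) q)).
    intros n q Hq; apply epsilon_spec, exists_split_jump; [|exact Hq].
    apply Rinv_0_lt_compat, lt_0_INR; lia. }
  destruct HJ as [J HJ].
  pose (u := node J p).
  assert (Hgood : forall a k, good (u a k)).
  { intros a k; induction k as [|k IH]; [exact Hp|]; unfold u; simpl.
    destruct (a k); [apply (HJ k _ IH)|apply good_wait, IH]. }
  assert (Htime_eq : forall a k, time (u a (S k)) = time (J k (u a k))).
  { intros a k; destruct (HJ k _ (Hgood a k)) as [(_ & _ & Ht & _) _].
    unfold u in *; simpl; destruct (a k); [reflexivity|simpl; lia]. }
  assert (Htime : forall a k, (time (u a k) < time (u a (S k)))%nat).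
  { intros a k; rewrite Htime_eq; apply (HJ k _ (Hgood a k)). }
  assert (Hreach : forall a k, reach F (u a k) (u a (S k))).
  { intros a k; pose proof (Hgood a k) as Hk; unfold u in *; simpl; destruct (a k).
    - apply (HJ k _ Hk).
    - apply reach_wait, Hk. }
  assert (Hlim : forall a k, agree (time (u a k)) (X (moves (u a k))) (X (limit_moves (u a)))).
  { intros a k; eapply agree_le, X_causal, continues_limit; auto. }
  exists (fun a => limit_moves (u a)); split; [|split].
  - intros a n; exists n; intros b Hab.
    apply (agree_le n (time (u a n))); [apply chain_time, Htime|].
    apply (agree_trans _ _ (X (moves (u a n)))); [apply agree_sym, Hlim|].
    unfold u; rewrite (node_agree J p a b n Hab); apply Hlim.
  - intros a k; exists (time (u a k)); intros b; induction k as [|k IH]; intros Hab.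
    + intros n Hn; lia.
    + assert (Hk : agree k a b).
      { apply IH; eapply agree_le; [|exact Hab]; specialize (Htime a k); lia. }
      assert (Hnode : u a k = u b k) by (apply node_agree, Hk).
      assert (Hak : a k = b k).
      { destruct (HJ k _ (Hgood a k)) as [_ Hsplit].
        pose proof (Hlim a (S k)) as Ha; pose proof (Hlim b (S k)) as Hb.
        rewrite Htime_eq in Ha, Hb, Hab; rewrite <- Hnode in Hb.
        assert (Hag := agree_trans _ _ _ _ (agree_trans _ _ _ _ Ha Hab) (agree_sym _ _ _ Hb)).
        unfold u in Hag, Hnode, Hsplit; simpl in Hag; rewrite <- Hnode in Hag.
        destruct (a k), (b k); try reflexivity; exfalso; apply Hsplit.
        - apply agree_sym, Hag.
        - exact Hag. }
      intros n Hn; destruct (Nat.eq_dec n k) as [->|Hne]; [exact Hak|apply Hk; lia].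
  - intros a; split.
    + intros Hr; apply NNPP; intros Hno.
      (* Infinitely many jumps occur, with tolerances tending to 0, which forces the payoff below
         [r]. *)
      assert (Htrue : forall N, exists k, (N <= k)%nat /\ a k = true).
      { intros N; apply NNPP; intros H; apply Hno; exists N; intros j Hj.
        destruct (a j) eqn:E; [|reflexivity]; exfalso; apply H; eauto. }
      assert (Hjump : forall k, a k = true -> jump (/ INR (S k)) (u a k) (u a (S k))).
      { intros k Hk; destruct (HJ k _ (Hgood a k)) as [Hj _].
        unfold u in *; simpl; rewrite Hk; exact Hj. }
      apply (Rle_not_lt _ _ Hr), payoff_limit_lt; [apply Hreach|apply Htime| |].
      * intros eps He; destruct (INR_unbounded (/ eps)) as [N HN].
        destruct (Htrue N) as (k & Hk & Hak); exists (S k).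
        destruct (Hjump k Hak) as (_ & _ & _ & Hc & _).
        assert (/ INR (S k) < eps); [|lra].
        rewrite <- (Rinv_inv eps); apply Rinv_lt_contravar.
        -- apply Rmult_lt_0_compat; [apply Rinv_0_lt_compat, He|apply lt_0_INR; lia].
        -- assert (INR N <= INR (S k)) by (apply le_INR; lia); lra.
      * intros N; destruct (Htrue N) as (k & Hk & Hak).
        destruct (Hjump k Hak) as (_ & _ & _ & _ & t & Ht & Hrt).
        pose proof (chain_time (u a) (Htime a) k); exists t; split; [lia|].
        rewrite (chain_moves F (u a) (Hreach a) (Htime a) (S k)) by lia; exact Hrt.
    + intros [k Hk].
      (* After the last jump only waiting occurs, so the limit is the continuation stored in a good
         position. *)
      assert (Hconst : forall j, (k <= j)%nat -> moves (u a j) = moves (u a k)).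
      { induction 1 as [|j Hj IH]; [reflexivity|].
        unfold u in *; simpl; rewrite (Hk j Hj); exact IH. }
      assert (E : limit_moves (u a) = moves (u a k)).
      { apply functional_extensionality; intros t.
        rewrite <- (Hconst (max k (S t))) by lia.
        apply (chain_moves F); [apply Hreach|apply Htime|].
        pose proof (chain_time (u a) (Htime a) (max k (S t))); lia. }
      rewrite E; apply Hgood.
Qed.

End Scheme.

(** * Countability of the eventually false sequences *)

(** Binary digits, lowest first, closed by a leading 1 that records the length. *)
Fixpoint code_bits (l : list bool) : nat :=
  match l with
  | nil => 1
  | cons b l => 2 * code_bits l + Nat.b2n b
  end.

Lemma code_bits_pos (l : list bool) : (0 < code_bits l)%nat.
Proof. induction l as [|b l IH]; simpl; lia. Qed.

Lemma code_bits_inj (l : list bool) : forall m, code_bits l = code_bits m -> l = m.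
Proof.
  induction l as [|b l IH]; intros [|c m] H; simpl in H.
  - reflexivity.
  - pose proof (code_bits_pos m); lia.
  - pose proof (code_bits_pos l); lia.
  - assert (b = c) as -> by (destruct b, c; simpl in H; try reflexivity; lia).
    f_equal; apply IH; lia.
Qed.

Lemma countable_eventually_false :
  countable_set (fun a : nat -> bool => exists k, forall j, (k <= j)%nat -> a j = false).
Proof.
  pose (stop := fun a : nat -> bool =>
    epsilon (inhabits 0%nat) (fun k => forall j, (k <= j)%nat -> a j = false)).
  exists (fun a => code_bits (map a (seq 0 (stop a)))); intros a b Ha Hb H.
  apply (epsilon_spec (inhabits 0%nat)) in Ha; fold (stop a) in Ha.
  apply (epsilon_spec (inhabits 0%nat)) in Hb; fold (stop b) in Hb.
  apply code_bits_inj in H.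
  assert (Hs : stop a = stop b).
  { apply (f_equal (@length bool)) in H; rewrite !length_map, !length_seq in H; exact H. }
  rewrite <- Hs in H, Hb; apply (prefix_agree (stop a)) in H.
  apply functional_extensionality; intros j.
  destruct (Nat.lt_ge_cases j (stop a)) as [Hj|Hj]; [apply H, Hj|].
  rewrite Ha, Hb by exact Hj; reflexivity.
Qed.

Lemma countable_set_image {B C : Type} (phi : B -> C) (P : B -> Prop) (Q : C -> Prop) :
  inhabited B -> countable_set P -> (forall x, Q x -> exists a, phi a = x /\ P a) ->
  countable_set Q.
Proof.
  intros HB [e He] HQ.
  pose (pre := fun x => epsilon HB (fun a => phi a = x /\ P a)).
  assert (Hpre : forall x, Q x -> phi (pre x) = x /\ P (pre x)).
  { intros x Hx; apply (epsilon_spec HB (fun a => phi a = x /\ P a)), HQ, Hx. }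
  exists (fun x => e (pre x)); intros x y Hx Hy H.
  destruct (Hpre x Hx) as [Ex Px], (Hpre y Hy) as [Ey Py].
  rewrite <- Ex, <- Ey; f_equal; apply He; assumption.
Qed.

(** * Plays against a fixed strategy *)

Lemma run_hist_prefix {A : Type} (sigma : strategyI A) (v : nat -> R) (t : nat) :
  run_hist sigma v t = prefix (run sigma v) t.
Proof.
  unfold prefix; induction t as [|t IH]; [reflexivity|].
  rewrite seq_S, map_app; simpl; rewrite <- IH; reflexivity.
Qed.

Lemma run_causal {A : Type} (sigma : strategyI A) (n : nat) (v w : nat -> R) :
  agree n v w -> agree (S n) (run sigma v) (run sigma w).
Proof.
  intros H t; induction t as [t IH] using (well_founded_induction Nat.lt_wf_0); intros Ht.
  unfold run; rewrite !run_hist_prefix.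
  assert (prefix (run sigma v) t = prefix (run sigma w) t) as ->.
  { apply prefix_agree; intros s Hs; apply IH; lia. }
  assert (vprefix v t = vprefix w t) as ->; [|reflexivity].
  apply (prefix_agree t v w); intros s Hs; apply H; lia.
Qed.

Theorem mainTheorem10 (A : Type) (T : list A -> Prop)
  (HAcount : countable_type A) (HAne : inhabited A)
  (Htree : is_tree T) (Hpruned : is_pruned T)
  (f : Branches T -> R)
  (Hf : no_increasing_seq_in_range f)
  (HI : I_wins f) :
  exists (r : R) (C : Branches T -> Prop),
    is_cantor_set C /\
    countable_set (fun x => C x /\ f x >= r) /\
    dense_in (fun x => C x /\ f x >= r) C.
Proof.
  destruct HI as [sigma Hsigma].
  assert (Hbranch : forall v, is_branch T (run sigma v)).
  { intros v [|n]; [|apply (Hsigma v)].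
    (* Winning speaks only of nonempty prefixes; the empty one comes from closure under initial
       segments. *)
    apply (Htree _ 0%nat (proj1 (Hsigma v) 0%nat)). }
  pose (play := fun v => exist (is_branch T) (run sigma v) (Hbranch v) : Branches T).
  pose (F := fun v => f (play v)).
  assert (F_run : forall v w, run sigma v = run sigma w -> F v = F w).
  { intros v w H; unfold F; f_equal; apply eq_sig_hprop; [|exact H].
    intros; apply proof_irrelevance. }
  assert (F_range : no_increasing_seq_in_range F).
  { intros (u & Hu & Hran); apply Hf; exists u; split; [exact Hu|].
    intros n; destruct (Hran n) as [v Hv]; exists (play v); exact Hv. }
  assert (F_limsup : forall v, LimSup_seq v <> Finite (F v)).
  { intros v; apply (proj2 (Hsigma v)); reflexivity. }
  destruct (exists_stable_cap_inf F F_range) as (p & r & Hp & Hinf).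
  destruct (exists_binary_scheme A F (run sigma) (run_causal sigma) F_run F_range F_limsup
    p r Hp Hinf) as (W & Wcont & Wopen & WF).
  pose (phi := fun a => play (W a)).
  exists r, (fun x => exists a, phi a = x); split; [|split; [|split]].
  - apply is_cantor_set_of_embedding; [exact Wcont|exact Wopen].
  - apply (countable_set_image phi _ _ (inhabits (fun _ => false)) countable_eventually_false).
    intros x [[a <-] Ha]; exists a; split; [reflexivity|]; apply WF, Rge_le, Ha.
  - intros x Hx; apply Hx.
  - intros U HU (x & [a <-] & Ha).
    destruct (cylinder_of_open U _ HU Ha) as [n Hn]; destruct (Wcont a n) as [k Hk].
    (* Truncating [a] keeps the point in [U] and makes the sequence eventually false, hence the
       payoff at least [r]. *)
    pose (b := fun j => if Nat.ltb j k then a j else false).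
    exists (phi b); split; [split; [exists b; reflexivity|]|].
    + apply Rle_ge, WF; exists k; intros j Hj; unfold b.
      destruct (Nat.ltb_spec j k); [lia|reflexivity].
    + apply Hn, Hk; intros j Hj; unfold b.
      destruct (Nat.ltb_spec j k); [reflexivity|lia].
Qed.
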